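(* Let $n$ be a positive integer, let $F$ be a field, let $A$ be a finite subset of $F$, and let $a_1,\ldots,a_n\in F^*$. If $p(F)\geqslant n(3n-5)/2$, then $$\bigl|\{a_1x_1+\cdots+a_nx_n:\ x_1,\ldots,x_n\in A,\ \text{and}\ x_i\neq x_j\ \text{if}\ i\neq j\}\bigr|\ \geqslant\ \min\bigl\{p(F)-\delta,\ n(|A|-n)+1\bigr\},$$ where $\delta=1$ if $n=2$ and $a_1=-a_2$, and $\delta=0$ otherwise.
   Context: $F^*=F\setminus\{0\}$. $p(F)$ denotes the additive order of the multiplicative identity of $F$: it equals the characteristic of $F$ if this is a prime, and $p(F)=+\infty$ if $F$ has characteristic zero (in which case $\min\{p(F)-c,\,x\}=x$ for integers $c,x$). *)

(* Defs.v *)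
From HB Require Import structures.
From mathcomp Require Import all_boot all_order all_algebra finmap.
From mathcomp Require Import boolp constructive_ereal.

Set Implicit Arguments.
Unset Strict Implicit.
Unset Printing Implicit Defensive.

Import Order.TTheory GRing.Theory Num.Theory.
Local Open Scope ring_scope.

(* The additive order of 1, valued in \bar rat so that it can be +oo and compared
   with untruncated differences of cardinals. *)
Definition order_one (F : fieldType) : \bar rat :=
  match pselect (exists m, (0 < m)%N && (m%:R == 0 :> F)) with
  | left exm => (ex_minn exm)%:R%:E
  | right _ => +oo%E
  end.

Lemma order_one_pchar (F : fieldType) (p : nat) :
  p \in [pchar F] -> order_one F = p%:R%:E.
Proof.
move=> Fp; have /andP[p_pr p0] := Fp.
rewrite /order_one; case: pselect => [exm|[]]; last first.
  by exists p; rewrite prime_gt0.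
case: ex_minnP => m /andP[m_gt0 m0] min_m.
have le_mp : (m <= p)%N by apply: min_m; rewrite p0 prime_gt0.
move: m0; rewrite -(dvdn_pcharf Fp) => /(dvdn_leq m_gt0) le_pm.
by rewrite (@anti_leq m p) // le_mp.
Qed.

Lemma order_one_pchar0 (F : fieldType) :
  [pchar F] =i pred0 -> order_one F = +oo%E.
Proof.
move=> F0; rewrite /order_one; case: pselect => // exm; exfalso.
have [/(_ F0) natF0 _] := pcharf0P F.
by case: exm => m; rewrite natF0; case: m.
Qed.

Definition distinct_sums (F : fieldType) (n : nat) (a : n.-tuple F)
    (A : {fset F}) : {fset F} :=
  [fset \sum_(i < n) tnth a i * fsval (tnth x i)
    | x in {: n.-tuple A} & uniq x]%fset.

(* a`_0 and a`_1 are the coefficients usually numbered a_1 and a_2. *)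
Definition delta (F : fieldType) (n : nat) (a : n.-tuple F) : nat :=
  ((n == 2) && (a`_0 == - a`_1)).

Lemma distinct_sumsP (F : fieldType) (n : nat) (a : n.-tuple F)
    (A : {fset F}) (y : F) :
  reflect (exists x : 'I_n -> F, [/\ forall i, x i \in A,
             forall i j, i != j -> x i != x j
           & y = \sum_(i < n) tnth a i * x i])
          (y \in distinct_sums a A).
Proof.
apply: (iffP (imfsetP _ _ _ _)) => [[x /andP[_ x_uniq] ->]|[x [xA x_inj ->]]].
  exists (fun i => fsval (tnth x i)); split=> // i j.
  by apply: contraNneq => /val_inj/(tuple_uniqP _ x_uniq) ->.
pose t := [tuple [` xA i]%fset | i < n].
have tE i : tnth t i = [` xA i]%fset by apply: tnth_mktuple.
have t_uniq : uniq t.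
  apply/tuple_uniqP => i j; rewrite !tE => -[xij].
  by apply/eqP; apply/negPn/negP => /x_inj; rewrite xij eqxx.
by exists t; [rewrite inE | apply: eq_bigr => i _; rewrite tE].
Qed.

(* Main.v *)
Require Import Defs.
From HB Require Import structures.
From mathcomp Require Import all_boot all_order all_algebra finmap.
From mathcomp Require Import boolp constructive_ereal.
From mathcomp Require Import fingroup perm zify ring lra.

Set Implicit Arguments.
Unset Strict Implicit.
Unset Printing Implicit Defensive.

Import Order.TTheory GRing.Theory Num.Theory.
Local Open Scope ring_scope.

(** The proof is by the polynomial method. Write l(x) = a_1 x_1 + ... + a_n x_n,
    let V be the Vandermonde polynomial in x_1, ..., x_n and let C be the set of
    sums to be bounded. If #|C| <= s, then V(x) times a product of s factors
    l(x) - c, every c in C being among these c, vanishes on A^n: either two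
    coordinates of x coincide, or l(x) lies in C. Hence no monomial
    x_1^(k_1) ... x_n^(k_n) with k_i < #|A| and with the top degree s + C(n, 2)
    can occur in V l^s. When s and the k_i are below the characteristic, the
    coefficient of this monomial is, up to a nonzero factor, the determinant of
    the matrix with entries b_i^j (k_i)_j, where b_i = 1 / a_i and (k)_j is the
    falling factorial; this is [ltn_card_distinct_sums]. The problem becomes that
    of finding exponents 0 <= k_i <= K with a prescribed sum for which this
    determinant, [ffact_det], is nonzero.

    The exponents are chosen one after the other. Once the leading minor on
    k_0, ..., k_(m-1) is nonzero, the next minor is a polynomial of degree m in
    k_m with nonzero leading coefficient, so one of any m + 1 consecutive values
    of k_m can be taken. Since the window of m + 1 values may be placed according
    to the partial sum obtained so far, the total is confined to an interval of n
    consecutive integers; this is [ffact_det_sum_between]. It settles every level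
    s at distance at least n from the characteristic p.

    Closer to p the sum has to be hit exactly, and the last two exponents are
    chosen together, on a line k_m + k_(m+1) = c with m = n - 2. There the
    determinant is a polynomial of degree 2 m + 1 whose leading coefficient is
    b_m + b_(m+1) up to a nonzero factor; this is [ffact_det_sum_eq]. After a
    permutation of the coefficients the sum b_m + b_(m+1) is nonzero, except when
    n = 2 and a_1 = - a_2: this is the origin of delta. The windows fit into
    [0, K] as soon as 5 n <= 2 K + 9, and p >= n (3 n - 5) / 2 is what makes this
    true for the values of K at which s comes within n of p. *)

(** * Coefficients of powers of a linear form *)

(** Keeping a bound [q] instead of the characteristic treats characteristic zero,
    where [q] may be taken as large as needed, together with characteristic [q]. *)
Definition natr_neq0_below (F : fieldType) (q : nat) :=
  forall m, (0 < m < q)%N -> m%:R != 0 :> F.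

Lemma factr_neq0 (F : fieldType) q m :
  natr_neq0_below F q -> (m < q)%N -> m`!%:R != 0 :> F.
Proof.
move=> Fq; elim: m => [|m IHm] lt_mq; first by rewrite oner_neq0.
by rewrite factS natrM mulf_neq0 ?(Fq m.+1) ?IHm ?(ltnW lt_mq).
Qed.

Definition trunc_exp (F : fieldType) (q : nat) (y : F) : {poly F} :=
  \poly_(m < q) (y ^+ m / m`!%:R).

(** The series identity exp(y_1 t) ... exp(y_r t) = exp((y_1 + ... + y_r) t), cut
    below degree [q]. It plays the part of the multinomial theorem, in a form that
    separates the variables. *)
Lemma coef_prod_trunc_exp (F : fieldType) q (I : Type) (r : seq I) (y : I -> F) m :
  natr_neq0_below F q -> (m < q)%N ->
  (\prod_(i <- r) trunc_exp q (y i))`_m = (\sum_(i <- r) y i) ^+ m / m`!%:R.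
Proof.
move=> Fq; elim: r m => [|i r IHr] m lt_mq.
  by rewrite !big_nil coef1 expr0n; case: m lt_mq => [|m] _; rewrite ?divr1 ?mul0r.
rewrite !big_cons coefM addrC exprDn mulr_suml; apply: eq_bigr => j _.
have le_jm : (j <= m)%N by rewrite -ltnS.
have lt_jq := leq_ltn_trans le_jm lt_mq.
have lt_mjq := leq_ltn_trans (leq_subr j m) lt_mq.
rewrite coef_poly lt_jq IHr // -mulr_natr -(bin_fact le_jm) !natrM.
have := factr_neq0 Fq lt_jq; have := factr_neq0 Fq lt_mjq.
have : ('C(m, j)%:R : F) != 0.
  apply: contraTneq (factr_neq0 Fq lt_mq) => bin0.
  by rewrite -(bin_fact le_jm) natrM bin0 mul0r eqxx.
by move=> C0 f0 g0; field; rewrite C0 f0 g0.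
Qed.

(** * Determinants *)

Lemma det_sum_rows (R : comNzRingType) n (T : finType)
    (g : 'I_n -> T -> 'I_n -> R) :
  \det (\matrix_(i, j) \sum_x g i x j)
  = \sum_(f : {ffun 'I_n -> T}) \det (\matrix_(i, j) g i (f i) j).
Proof.
rewrite /determinant exchange_big /=; apply: eq_bigr => s _.
rewrite -mulr_sumr; congr (_ * _).
under eq_bigr => i _ do rewrite mxE.
rewrite bigA_distr_bigA /=; apply: eq_bigr => f _.
by apply: eq_bigr => i _; rewrite mxE.
Qed.

Lemma det_scale_rows (R : comNzRingType) n (c : 'I_n -> R) (M : 'M[R]_n) :
  \det (\matrix_(i, j) (c i * M i j)) = (\prod_i c i) * \det M.
Proof.
have -> : \matrix_(i, j) (c i * M i j) = diag_mx (\row_i c i) *m M.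
  by apply/matrixP=> i j; rewrite mul_diag_mx !mxE.
by rewrite det_mulmx det_diag; congr (_ * _); apply: eq_bigr => i _; rewrite mxE.
Qed.

Lemma det_scale_cols (R : comNzRingType) n (c : 'I_n -> R) (M : 'M[R]_n) :
  \det (\matrix_(i, j) (c j * M i j)) = (\prod_i c i) * \det M.
Proof.
rewrite -[in RHS]det_tr -det_scale_rows -det_tr; congr (\det _).
by apply/matrixP=> i j; rewrite !mxE.
Qed.

(** Multiplying column [j] by 'X^j makes every entry of row [i] divisible by
    'X^(k i). Comparing the two factorizations, the power 'X^'C(n, 2) coming from
    the columns cancels against the sum of the [k i], and 'X^s remains; the
    cofactor at 0 is the determinant of the lowest coefficients. *)
Lemma det_lowest_coef (F : fieldType) n s (k : 'I_n -> nat) (M : 'M[{poly F}]_n)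
    (L : 'M[F]_n) :
  (\sum_i k i = s + 'C(n, 2))%N ->
  (forall (i j : 'I_n) m, (m + j <= k i)%N ->
     (M i j)`_m = if (m + j)%N == k i then L i j else 0) ->
  (forall i j : 'I_n, (k i < j)%N -> L i j = 0) ->
  exists2 P : {poly F}, \det M = P * 'X^s & P`_0 = \det L.
Proof.
move=> sum_k lowM L0.
pose Q := \matrix_(i, j) drop_poly (k i) ('X^j * M i j).
have QE : \matrix_(i, j) ('X^(k i) * Q i j) = \matrix_(i, j) ('X^(j : 'I_n) * M i j).
  apply/matrixP => i j; rewrite !mxE -[RHS](poly_take_drop (k i)) mulrC.
  rewrite [take_poly _ _](_ : _ = 0) ?add0r //; apply/polyP => m.
  rewrite coef_take_poly coef0; case: ltnP => // lt_m.
  rewrite coefXnM; case: ltnP => // le_jm.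
  by rewrite lowM ?subnK ?(ltnW lt_m) // ltn_eqF.
exists (\det Q).
  have Xn0 m : 'X^m != 0 :> {poly F} by rewrite expf_neq0 ?polyX_eq0.
  apply: (mulIf (Xn0 'C(n, 2))); rewrite -mulrA -exprD -sum_k.
  have <- : \prod_(i < n) 'X^i = 'X^'C(n, 2) :> {poly F}.
    by rewrite prodrXr -bin2_sum big_mkord.
  by rewrite -prodrXr mulrC -det_scale_cols -QE det_scale_rows mulrC.
rewrite -horner_coef0 -[LHS]/(horner_eval 0 (\det Q)) -det_map_mx; congr (\det _).
apply/matrixP => i j; rewrite !mxE /= /horner_eval horner_coef0 coef_drop_poly add0n.
rewrite coefXnM; case: ltnP => [lt_kj|le_jk]; first by rewrite L0.
by rewrite lowM ?subnK // eqxx.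
Qed.

(** * The polynomial method *)

(** These weights read off the coefficient of [x^k] in a polynomial of degree at
    most [k] from its values at [#|T|] points: they solve a Vandermonde system. *)
Lemma dual_weights (F : fieldType) (T : finType) (v : T -> F) (k : nat) (z : F) :
  injective v -> (k < #|T|)%N ->
  exists w : T -> F,
    forall j, (j <= k)%N -> \sum_x w x * v x ^+ j = if j == k then z else 0.
Proof.
move=> v_inj lt_k.
pose V := Vandermonde #|T| (\row_(i < #|T|) v (enum_val i)).
have V_unit : V \in unitmx.
  rewrite unitmxE det_Vandermonde unitfE; apply/prodf_neq0 => i _.
  apply/prodf_neq0 => j lt_ij; rewrite !mxE subr_eq0.
  by apply: contraTneq lt_ij => /v_inj/enum_val_inj->; rewrite ltnn.
pose u := invmx V *m (z *: delta_mx (Ordinal lt_k) 0 : 'cV_#|T|).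
have Vu : V *m u = z *: delta_mx (Ordinal lt_k) 0 by rewrite mulKVmx.
exists (fun x => u (enum_rank x) 0) => j le_jk.
have lt_j : (j < #|T|)%N := leq_ltn_trans le_jk lt_k.
have /matrixP/(_ (Ordinal lt_j) 0) := Vu; rewrite !mxE -val_eqE /= andbT => Vuj.
have -> : (if j == k then z else 0) = z * (j == k)%:R.
  by case: eqP; rewrite ?mulr1 ?mulr0.
rewrite -{}Vuj (reindex (fun i : 'I_#|T| => enum_val i)) /=;
  last by apply: onW_bij; apply: enum_val_bij.
by apply: eq_bigr => i _; rewrite !mxE enum_valK mulrC.
Qed.

(** The coefficient of the product of the [x_i ^ (k i)] in the Vandermonde
    polynomial times the s-th power of the sum of the [x_i / b i], divided by
    [s`!] and by the product of the [(b i)^-1 ^ (k i) / (k i)`!], where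
    [\sum_i k i = s + 'C(n, 2)], for [s] and the [k i] below the characteristic. *)
Definition ffact_det (F : fieldType) n (b : nat -> F) (k : nat -> nat) : F :=
  \det (\matrix_(i < n, j < n) (b i ^+ j * (k i ^_ j)%:R)).

(** If the conclusion fails, some monic univariate [p] of degree [s] vanishes on
    all sums, so V(x) p(l(x)) vanishes on A^n. Applying in each variable the
    weights that read off the coefficient of [x_i ^ (k i)] keeps, by the choice of
    degrees, only the contribution of V l^s, namely [s`!] times [ffact_det]. The
    expansion of V l^m for all m at once is the determinant of the polynomial
    matrix [M], in which the powers of 'X record the powers of l. *)
Lemma ltn_card_distinct_sums (F : fieldType) n (a : n.-tuple F) (A : {fset F})
    q s (k : nat -> nat) :
  natr_neq0_below F q -> (forall i, tnth a i != 0) ->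
  (forall i : 'I_n, k i < q)%N -> (forall i : 'I_n, k i < #|` A|)%N ->
  (s < q)%N -> (\sum_(i < n) k i = s + 'C(n, 2))%N ->
  ffact_det n (fun i => (a`_i)^-1) k != 0 ->
  (s < #|` distinct_sums a A|)%N.
Proof.
move=> Fq a_neq0 lt_kq lt_kA lt_sq sum_k; apply: contra_neqT; rewrite -leqNgt => le_Cs.
(* This normalization makes the lowest coefficients of [M] equal to the entries
   of [ffact_det]. *)
pose z (i : 'I_n) := (k i)`!%:R / tnth a i ^+ k i.
have /choice[w wP] (i : 'I_n) : exists w : A -> F, forall j, (j <= k i)%N ->
    \sum_x w x * val x ^+ j = if j == k i then z i else 0.
  by apply: dual_weights; [apply: val_inj | rewrite -cardfE lt_kA].
pose g (i : 'I_n) (x : A) (j : 'I_n) :=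
  (w i x *: trunc_exp q (tnth a i * val x)) * (val x ^+ j)%:P.
pose ell (f : {ffun 'I_n -> A}) := \sum_i tnth a i * val (f i).
pose V (f : {ffun 'I_n -> A}) := \det (\matrix_(i < n, j < n) val (f i) ^+ j).
pose wt (f : {ffun 'I_n -> A}) := (\prod_i w i (f i)) * V f.
pose M := \matrix_(i, j) \sum_x g i x j.
have detM : \det M = \sum_f wt f *: \prod_i trunc_exp q (tnth a i * val (f i)).
  rewrite det_sum_rows; apply: eq_bigr => f _.
  pose c i : {poly F} := w i (f i) *: trunc_exp q (tnth a i * val (f i)).
  pose W := map_mx polyC (\matrix_(i < n, j < n) val (f i) ^+ j).
  have -> : \matrix_(i, j) g i (f i) j = \matrix_(i, j) (c i * W i j).
    by apply/matrixP => i j; rewrite !mxE.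
  rewrite det_scale_rows det_map_mx scaler_prod /=.
  by rewrite mulrC mul_polyC scalerA mulrC.
have coefM m : (m < q)%N -> (\det M)`_m = \sum_f wt f * (ell f ^+ m / m`!%:R).
  move=> lt_mq; rewrite detM coef_sum; apply: eq_bigr => f _.
  by rewrite coefZ (coef_prod_trunc_exp _ _ Fq).
have [||P detMP P0] := @det_lowest_coef F n s k M
    (\matrix_(i, j) ((a`_i)^-1 ^+ j * (k i ^_ j)%:R)) sum_k.
- move=> i j m le_mk; rewrite !mxE coef_sum.
  have lt_mq : (m < q)%N.
    by rewrite (leq_ltn_trans _ (lt_kq i)) // (leq_trans _ le_mk) ?leq_addr.
  transitivity (tnth a i ^+ m / m`!%:R * \sum_x w i x * val x ^+ (m + j)).
    rewrite mulr_sumr; apply: eq_bigr => x _.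
    rewrite /g coefMC coefZ coef_poly lt_mq exprMn exprD; ring.
  rewrite wP //; case: eqP => [kE|_]; last by rewrite mulr0.
  rewrite /z -(tnth_nth 0) -kE exprD exprVn.
  have -> : ((m + j) ^_ j)%:R = (m + j)`!%:R / m`!%:R :> F.
    rewrite -(@ffact_fact (m + j) j) ?leq_addl // addnK natrM mulfK //.
    exact: factr_neq0 Fq lt_mq.
  by field; rewrite !expf_neq0 ?(factr_neq0 Fq).
- by move=> i j lt_kj; rewrite mxE ffact_small ?mulr0.
rewrite /ffact_det -{}P0.
have coefM0 m : (m < s)%N -> (\det M)`_m = 0.
  by move=> lt_ms; rewrite detMP coefMXn lt_ms.
have coefMs : (\det M)`_s = P`_0 by rewrite detMP coefMXn ltnn subnn.
pose C := distinct_sums a A.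
(* The padding by a power of 'X brings the degree to exactly [s]. *)
pose p : {poly F} := \prod_(c <- C) ('X - c%:P) * 'X^(s - #|` C|).
have size_p : size p = s.+1.
  rewrite size_Mmonic ?monic_neq0 ?monicXn ?monic_prod_XsubC //.
  by rewrite size_prod_XsubC size_polyXn addnS /= addSn subnKC.
have p_s : p`_s = 1.
  have : p \is monic by rewrite monicMl ?monicXn ?monic_prod_XsubC.
  by rewrite monicE lead_coefE size_p /= => /eqP.
have wt_p f : wt f * p.[ell f] = 0.
  (* Two equal coordinates kill V, and otherwise [ell f] is a root of [p]. *)
  have [f_inj|/injectivePn[i1 [i2 ne_i eq_f]]] := boolP (injectiveb f).
    have fC : ell f \in C.
      apply/distinct_sumsP; exists (fun i => val (f i)); split=> //.
        by move=> i; apply: valP.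
      by move=> i j; apply: contra_neq => /val_inj/(injectiveP _ f_inj).
    suff /rootP-> : root p (ell f) by rewrite mulr0.
    by rewrite rootM root_prod_XsubC fC.
  rewrite /wt /V (determinant_alternate ne_i) ?mulr0 ?mul0r // => j.
  by rewrite !mxE eq_f.
have : \sum_f wt f * p.[ell f] = s`!%:R * P`_0.
  under eq_bigr do rewrite horner_coef size_p mulr_sumr.
  rewrite exchange_big /= big_ord_recr /= big1 ?add0r => [|m _].
    rewrite -coefMs coefM // mulr_sumr; apply: eq_bigr => f _.
    by rewrite p_s mul1r; field; apply: factr_neq0 Fq _.
  have lt_mq := ltn_trans (ltn_ord m) lt_sq.
  transitivity (p`_m * m`!%:R * (\det M)`_m); last by rewrite coefM0 ?mulr0.
  rewrite coefM // mulr_sumr; apply: eq_bigr => f _.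
  by field; apply: factr_neq0 Fq _.
rewrite big1 => [|f _]; last exact: wt_p.
move=> /esym/eqP; rewrite mulf_eq0 (negPf (factr_neq0 Fq lt_sq)) /=.
by move/eqP.
Qed.

(** * Nonvanishing of the determinant *)

Definition ffact_poly (F : fieldType) j : {poly F} := \prod_(r < j) ('X - r%:R%:P).

Lemma size_ffact_poly (F : fieldType) j : size (ffact_poly F j) = j.+1.
Proof. by rewrite size_prod_XsubC /index_enum -enumT size_enum_ord. Qed.

Lemma lead_coef_ffact_poly (F : fieldType) j : lead_coef (ffact_poly F j) = 1.
Proof. by apply/eqP; rewrite -monicE monic_prod_XsubC. Qed.

Lemma horner_ffact_poly (F : fieldType) j (k : nat) :
  (ffact_poly F j).[k%:R] = (k ^_ j)%:R.
Proof.
elim: j => [|j IHj]; first by rewrite /ffact_poly big_ord0 hornerC.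
rewrite /ffact_poly big_ord_recr hornerM -/(ffact_poly F j) IHj ffactnSr natrM.
rewrite hornerXsubC; case: (leqP j k) => [/natrB->//|lt_kj].
by rewrite ffact_small ?mul0r.
Qed.

(** The Schur complement of the leading block of size [m]. Entry [e] of the
    reduced row with parameter [c] is [c ^+ (m + e)] times a falling factorial of
    degree [m + e], minus a combination of the falling factorials of degree less
    than [m] whose coefficients depend on the rows already chosen; this combination
    cannot affect the leading term. *)
Lemma ffact_det_extend (F : fieldType) m d (b : nat -> F) (k : nat -> nat) :
  ffact_det m b k != 0 ->
  exists2 U : 'I_d -> F -> {poly F},
    forall e c, c != 0 ->
      size (U e c) = (m + e).+1 /\ lead_coef (U e c) = c ^+ (m + e)
  & forall k', (forall i, (i < m)%N -> k' i = k i) ->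
      ffact_det (m + d) b k'
      = ffact_det m b k
        * \det (\matrix_(i < d, e < d) (U e (b (m + i)%N)).[(k' (m + i)%N)%:R]).
Proof.
pose S n n' (k' : nat -> nat) := \matrix_(i < n, j < n') (b i ^+ j * (k' i ^_ j)%:R).
rewrite /ffact_det -/(S m m k) => B_neq0.
have B_unit : S m m k \in unitmx by rewrite unitmxE unitfE.
pose C : 'M_(m, d) := \matrix_(i, e) (b i ^+ (m + e) * (k i ^_ (m + e))%:R).
pose X := invmx (S m m k) *m C.
pose low (e : 'I_d) (c : F) := \sum_(j < m) (c ^+ j * X j e) *: ffact_poly F j.
exists (fun (e : 'I_d) c => c ^+ (m + e) *: ffact_poly F (m + e) - low e c).
  move=> e c c_neq0.
  have cX0 : c ^+ (m + e) != 0 by rewrite expf_neq0.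
  have size_low : (size (- low e c) < size (c ^+ (m + e) *: ffact_poly F (m + e)))%N.
    rewrite size_polyN size_scale // size_ffact_poly ltnS.
    apply: leq_trans (size_sum _ _ _) _; apply/bigmax_leqP => j _.
    apply: leq_trans (size_scale_leq _ _) _; rewrite size_ffact_poly.
    exact: leq_trans (ltn_ord j) (leq_addr _ _).
  rewrite size_polyDl // lead_coefDl // lead_coefZ lead_coef_ffact_poly mulr1.
  by rewrite size_scale // size_ffact_poly.
move=> k' k'E; rewrite -/(S (m + d)%N (m + d)%N k').
pose T : 'M_(m + d) := block_mx 1%:M (- X) 0 1%:M.
have <- : \det (S (m + d)%N (m + d)%N k' *m T) = \det (S (m + d)%N (m + d)%N k').
  by rewrite det_mulmx det_ublock !det1 !mulr1.
have ulE : ulsubmx (S (m + d)%N (m + d)%N k') = S m m k.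
  by apply/matrixP => i j; rewrite !mxE /= k'E.
have urE : ursubmx (S (m + d)%N (m + d)%N k') = C.
  by apply/matrixP => i j; rewrite !mxE /= k'E.
rewrite -[S (m + d)%N _ _]submxK /T mulmx_block ulE urE !mulmx1 !mulmx0 !addr0.
rewrite !mulmxN mulKVmx // addNr det_lblock; congr (_ * \det _).
apply/matrixP => i e; rewrite !mxE hornerD hornerN hornerZ horner_ffact_poly.
rewrite addrC; congr (_ - _).
rewrite /low horner_sum; apply: eq_bigr => j _.
by rewrite hornerZ horner_ffact_poly !mxE /= mulrAC.
Qed.

Lemma exists_nonroot (F : fieldType) q (p : {poly F}) l t :
  natr_neq0_below F q -> p != 0 -> (size p <= t.+1)%N -> (l + t < q)%N ->
  exists2 x, (l <= x <= l + t)%N & p.[x%:R] != 0.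
Proof.
move=> Fq p_neq0 size_p lt_ltq.
pose s : seq F := [seq x%:R | x <- iota l t.+1].
have s_uniq : uniq s.
  rewrite map_inj_in_uniq ?iota_uniq // => x y; rewrite !mem_iota => x_in y_in.
  wlog le_xy : x y x_in y_in / (x <= y)%N.
    move=> IH; have [|/ltnW] := leqP x y; first exact: IH.
    by move=> le_yx /esym/(IH _ _ y_in x_in le_yx)->.
  move=> eq_xy; apply: contraTeq isT => ne_xy.
  have := Fq (y - x)%N; rewrite natrB // eq_xy subrr eqxx; lia.
have : ~~ all (root p) s.
  apply: contraL size_p => /max_poly_roots-/(_ p_neq0 s_uniq).
  by rewrite size_map size_iota -ltnNge.
rewrite -has_predC has_map => /hasP[x]; rewrite mem_iota => x_in /= px_neq0.
by exists x => //; lia.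
Qed.

Lemma leq_bin2_mul m K : (m <= K.+1)%N -> ('C(m, 2) <= m * K)%N.
Proof.
move=> le_mK; rewrite bin2 -divn2 (leq_trans (leq_div _ _)) // leq_mul2l.
by apply/orP; lia.
Qed.

(** Row [m] admits some value in any window of [m + 1] consecutive ones, and the
    window is placed after the sum of the previous exponents is known. The target
    interval therefore needs only room for the last window; the first alternative
    of the last hypothesis covers the small [K] for which the windows cannot be
    moved inside [0, K], so that their widths add up to ['C(n, 2)]. *)
Lemma ffact_det_sum_between (F : fieldType) q K (b : nat -> F) n alpha beta :
  natr_neq0_below F q -> (K < q)%N -> (forall i, (i < n)%N -> b i != 0) ->
  (n <= K.+1)%N ->
  (alpha + 'C(n, 2) <= n * K)%N -> ('C(n, 2) <= beta)%N ->
  (alpha + 'C(n, 2) <= beta)%N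
    || (2 * n <= K + 3)%N && (alpha + n <= beta.+1)%N ->
  exists k : nat -> nat, [/\ forall i, (k i <= K)%N,
    (alpha <= \sum_(i < n) k i <= beta)%N & ffact_det n b k != 0].
Proof.
move=> Fq lt_Kq; elim: n alpha beta => [|m IHm] alpha beta b_neq0 le_mK le_al le_be gap.
  exists (fun=> 0%N); split=> //; first by rewrite big_ord0; lia.
  by rewrite /ffact_det det_mx00 oner_neq0.
have binS2 : 'C(m.+1, 2) = ('C(m, 2) + m)%N by rewrite binS bin1.
have bin_ge : (2 * m <= 'C(m.+1, 2) + 1)%N.
  by elim: (m) => [|j]; rewrite ?bin0n // => IHj; rewrite binS bin1; case: j IHj; lia.
rewrite binS2 mulSn in le_al le_be gap bin_ge *.
have bin_le : ('C(m, 2) <= m * K)%N by apply: leq_bin2_mul; lia.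
(* From a previous sum in this interval a window [l, l + m] inside [0, K] can be
   placed so that every choice in it lands in [alpha, beta]. *)
have [|||||k [k_le sum_k k_neq0]] := IHm (alpha - (K - m))%N (beta - m)%N; try lia.
  by move=> i lt_im; apply: b_neq0; apply: ltnW.
set sk := (\sum_(i < m) k i)%N in sum_k.
have [U sizeU detU] := ffact_det_extend 1 k_neq0.
have [size_U _] := sizeU 0 (b m) (b_neq0 m (ltnSn m)).
have [|||x x_in Ux] := @exists_nonroot F q (U 0 (b m)) (alpha - sk)%N m Fq.
- by rewrite -size_poly_eq0 size_U.
- by rewrite size_U addn0.
- lia.
exists (fun i => if i == m then x else k i); split.
- by move=> i; case: ifP => _; [lia | apply: k_le].
- rewrite big_ord_recr /= eqxx.
  under eq_bigr => i _ do rewrite ltn_eqF //.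
  rewrite -/sk; lia.
- rewrite -addn1 detU => [|i lt_im]; last by rewrite ltn_eqF.
  by rewrite mulf_neq0 // det_mx11 mxE addn0 eqxx.
Qed.

(** The first [m] exponents are chosen so that the remainder [c] lies in
    [2 m + 1, 2 K - 2 m - 1], an interval long enough for
    [ffact_det_sum_between] when [5 m + 1 <= 2 K]. On the line of pairs
    [(x, c - x)] the 2 x 2 Schur complement is a polynomial in [x] of degree
    [2 m + 1], and the bounds on [c] say that [2 m + 2] consecutive values of [x]
    keep both [x] and [c - x] in [0, K]. *)
Lemma ffact_det_sum_eq (F : fieldType) q K (b : nat -> F) m T :
  natr_neq0_below F q -> (K < q)%N -> (forall i, (i < m.+2)%N -> b i != 0) ->
  b m + b m.+1 != 0 -> (5 * m + 1 <= 2 * K)%N ->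
  ('C(m.+2, 2) <= T)%N -> (T + 'C(m.+2, 2) <= m.+2 * K)%N ->
  exists k : nat -> nat, [/\ forall i, (k i <= K)%N,
    (\sum_(i < m.+2) k i)%N = T & ffact_det m.+2 b k != 0].
Proof.
move=> Fq lt_Kq b_neq0 b_sum le_mK le_T le_TK.
have binSS2 : 'C(m.+2, 2) = ('C(m, 2) + 2 * m + 1)%N by rewrite !binS !bin1 bin0; lia.
have bin_ge : (m <= 'C(m, 2) + 1)%N.
  by elim: (m) => [|j]; rewrite ?bin0n // => IHj; rewrite binS bin1; lia.
have bin_le : ('C(m, 2) <= m * K)%N by apply: leq_bin2_mul; lia.
rewrite binSS2 !mulSn in le_T le_TK.
have [|||||k [k_le sum_k k_neq0]] := @ffact_det_sum_between F q K b m
    (T - (2 * K - 2 * m - 1))%N (T - (2 * m + 1))%N Fq lt_Kq; try lia.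
  by move=> i lt_im; apply: b_neq0; lia.
set sk := (\sum_(i < m) k i)%N in sum_k.
pose c := (T - sk)%N.
have [U sizeU detU] := ffact_det_extend 2 k_neq0.
have b0 : b m != 0 by apply: b_neq0; lia.
have b1 : b m.+1 != 0 by apply: b_neq0; lia.
pose i0 : 'I_2 := 0; pose i1 : 'I_2 := 1.
(* Substituting [r] for 'X expresses the last row in terms of the last but one. *)
pose r : {poly F} := c%:R%:P - 'X.
have rE : r = - ('X - c%:R%:P) by rewrite opprB.
have size_r : size r = 2 by rewrite rE size_polyN size_XsubC.
have lead_r : lead_coef r = -1 by rewrite rE lead_coefN lead_coefXsubC.
pose p e e' : {poly F} := U e (b m) * (U e' (b m.+1) \Po r).
have pE (e e' : 'I_2) : (e + e' = 1)%N -> size (p e e') = (2 * m + 2)%N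
    /\ lead_coef (p e e') = b m ^+ (m + e) * b m.+1 ^+ (m + e') * (-1) ^+ (m + e').
  move=> ee'; have [sz ld] := sizeU e _ b0; have [sz' ld'] := sizeU e' _ b1.
  split; last by rewrite lead_coefM lead_coef_comp ?size_r // ld ld' lead_r sz' mulrA.
  have U_neq0 : U e (b m) != 0 by rewrite -size_poly_eq0 sz.
  have Ur_neq0 : U e' (b m.+1) \Po r != 0.
    by rewrite -size_poly_eq0 size_comp_poly2 // sz'.
  by rewrite size_mul // size_comp_poly2 // sz sz'; lia.
have [size01 lead01] := pE i0 i1 erefl; have [size10 lead10] := pE i1 i0 erefl.
pose P := p i0 i1 - p i1 i0.
have size_P : (size P <= (2 * m + 1).+1)%N.
  by rewrite (leq_trans (size_polyD _ _)) // size_polyN size01 size10; lia.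
have P_neq0 : P != 0.
  apply: contraNneq b_sum => P0.
  have : lead_coef (p i0 i1) = lead_coef (p i1 i0).
    by rewrite -[p i0 i1](subrK (p i1 i0)) -/P P0 add0r.
  rewrite lead01 lead10 /= addn0 addn1 !exprS => /eqP; rewrite -subr_eq0.
  set u := b m ^+ m; set v := b m.+1 ^+ m; set e := (-1) ^+ m.
  have -> : u * (b m.+1 * v) * (-1 * e) - b m * u * v * e
            = - (u * v * e) * (b m + b m.+1) by ring.
  rewrite mulf_eq0 oppr_eq0 => /orP[|//].
  by rewrite !mulf_eq0 !expf_eq0 oppr_eq0 oner_eq0 (negPf b0) (negPf b1) !andbF.
have [|x x_in Px] := @exists_nonroot F q P (c - K)%N (2 * m + 1) Fq P_neq0 size_P.
  rewrite /c; lia.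
pose k' i := if i == m then x else if i == m.+1 then (c - x)%N else k i.
exists k'; split.
- by move=> i; rewrite /k'; case: ifP => _; [|case: ifP => _; last exact: k_le];
    rewrite /c in x_in *; lia.
- rewrite !big_ord_recr /= /k' !eqxx -[m.+1 == m]/(m.+1 == m) gtn_eqF //.
  under eq_bigr => i _.
    rewrite ltn_eqF // ltn_eqF; last by rewrite ltnS ltnW.
    over.
  rewrite -/sk /c in x_in *; lia.
have k'E i : (i < m)%N -> k' i = k i.
  by move=> lt_im; rewrite /k' !ltn_eqF // ltnS ltnW.
rewrite -[m.+2]addn2 (detU _ k'E) mulf_neq0 //.
have k'0 : (k' (m + 0)%N)%:R = x%:R :> F by rewrite /k' addn0 eqxx.
have k'1 : (k' (m + 1)%N)%:R = r.[x%:R].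
  rewrite /k' addn1 gtn_eqF // eqxx /r !hornerE natrB //.
  by rewrite /c; lia.
rewrite (expand_det_row _ 0) !big_ord_recl big_ord0 addr0 /cofactor !det_mx11.
rewrite !mxE /= /bump /= k'0 k'1 addn0 addn1.
have -> : lift ord0 0 = i1 by apply: val_inj.
have -> : lift i1 0 = i0 by apply: val_inj.
move: Px; rewrite /P /p /r !(hornerE, horner_comp) /=.
by rewrite expr0 expr1 mulr1 mulrN1 mulNr.
Qed.

(** * Lower bounds for the number of sums *)

Lemma distinct_sums_perm (F : fieldType) n (a : n.-tuple F) (A : {fset F})
    (s : {perm 'I_n}) :
  distinct_sums [tuple tnth a (s i) | i < n] A = distinct_sums a A.
Proof.
apply/fsetP => y; apply/distinct_sumsP/distinct_sumsP => -[x [xA x_inj ->]].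
  exists (fun i => x ((s^-1)%g i)); split=> // [i j ne_ij|].
    by apply: x_inj; rewrite (inj_eq perm_inj).
  rewrite [RHS](reindex_inj (@perm_inj _ s)) /=.
  by apply: eq_bigr => i _; rewrite tnth_mktuple permK.
exists (fun i => x (s i)); split=> // [i j ne_ij|].
  by apply: x_inj; rewrite (inj_eq perm_inj).
rewrite (reindex_inj (@perm_inj _ s)) /=.
by apply: eq_bigr => i _; rewrite tnth_mktuple.
Qed.

Lemma double_bin2 n : (2 * 'C(n, 2) + n = n * n)%N.
Proof. by elim: n => [|n IHn]; rewrite ?bin0n // binS bin1; lia. Qed.

(** At distance [n] below [q] it suffices that the exponents reach some level
    between [N] and [q - 1]. *)
Lemma ltn_card_distinct_sums_slack (F : fieldType) n (a : n.-tuple F)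
    (A : {fset F}) q K N :
  natr_neq0_below F q -> (forall i, tnth a i != 0) ->
  (K < q)%N -> (K < #|` A|)%N -> (n <= K.+1)%N ->
  (N + n * n <= n * K + n)%N -> (N + n <= q)%N ->
  (2 * n <= K + 3)%N || (N + 'C(n, 2) < q)%N ->
  (N < #|` distinct_sums a A|)%N.
Proof.
move=> Fq a_neq0 lt_Kq lt_KA le_nK le_NK le_Nq gap.
have bin2E := double_bin2 n.
have b_neq0 i : (i < n)%N -> (a`_i)^-1 != 0.
  by move=> lt_in; rewrite invr_eq0 -(tnth_nth 0 a (Ordinal lt_in)).
have [|||k [k_le sum_k k_neq0]] :=
  @ffact_det_sum_between F q K (fun i => (a`_i)^-1) n
    (N + 'C(n, 2)) (q.-1 + 'C(n, 2)) Fq lt_Kq b_neq0 le_nK; try lia.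
set S := (\sum_(i < n) k i)%N in sum_k.
have lt_sC : (S - 'C(n, 2) < #|` distinct_sums a A|)%N.
  apply: (@ltn_card_distinct_sums F n a A q _ k Fq a_neq0) => //.
  - by move=> i; apply: leq_ltn_trans (k_le i) lt_Kq.
  - by move=> i; apply: leq_ltn_trans (k_le i) lt_KA.
  - lia.
  - rewrite -/S; lia.
lia.
Qed.

(** A permutation moves the non-opposite coefficients to the last two places,
    where [ffact_det_sum_eq] needs them. *)
Lemma ltn_card_distinct_sums_exact (F : fieldType) n (a : n.-tuple F)
    (A : {fset F}) q K s (i j : 'I_n) :
  natr_neq0_below F q -> (forall i, tnth a i != 0) ->
  i != j -> tnth a i + tnth a j != 0 ->
  (K < q)%N -> (K < #|` A|)%N -> (5 * n <= 2 * K + 9)%N ->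
  (s + n * n <= n * K + n)%N -> (s < q)%N ->
  (s < #|` distinct_sums a A|)%N.
Proof.
move=> Fq a_neq0 ne_ij aij_neq0 lt_Kq lt_KA le_nK le_sK lt_sq.
have n_gt1 : (1 < n)%N.
  by move: ne_ij; rewrite -val_eqE /=; have := ltn_ord i; have := ltn_ord j; lia.
case: n n_gt1 => [|[|m]] // _ in a i j a_neq0 ne_ij aij_neq0 le_nK le_sK *.
have bin2E := double_bin2 m.+2.
have lt_m : (m < m.+2)%N by [].
pose u : 'I_m.+2 := Ordinal lt_m; pose v : 'I_m.+2 := ord_max.
pose s1 := tperm u i; pose sg := (tperm v (s1 j) * s1)%g.
have ne_uv : u != v by rewrite -val_eqE /= ltn_eqF.
have sgv : sg v = j by rewrite permM tpermL tpermK.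
have sgu : sg u = i.
  rewrite permM tpermD ?tpermL // eq_sym //.
  apply: contra_neq ne_ij => uE; apply: (perm_inj (s := s1)).
  by rewrite -uE tpermR.
pose a' := [tuple tnth a (sg i) | i < m.+2].
rewrite -(distinct_sums_perm a A sg) -/a'.
have a'E (k : 'I_m.+2) : a'`_k = tnth a (sg k) by rewrite -tnth_nth tnth_mktuple.
have a'_neq0 k : tnth a' k != 0 by rewrite tnth_mktuple.
have b_neq0 k : (k < m.+2)%N -> (a'`_k)^-1 != 0.
  by move=> lt_k; rewrite invr_eq0 -(tnth_nth 0 a' (Ordinal lt_k)).
have b_sum : (a'`_m)^-1 + (a'`_m.+1)^-1 != 0.
  rewrite (a'E u) (a'E v) sgu sgv.
  have -> : (tnth a i)^-1 + (tnth a j)^-1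
            = (tnth a i + tnth a j) / (tnth a i * tnth a j).
    by field; rewrite !a_neq0.
  by rewrite mulf_neq0 ?invr_eq0 ?mulf_neq0.
have [|||k [k_le sum_k k_neq0]] :=
  @ffact_det_sum_eq F q K (fun i => (a'`_i)^-1) m (s + 'C(m.+2, 2)) Fq lt_Kq
    b_neq0 b_sum; try lia.
apply: (@ltn_card_distinct_sums F _ a' A q _ k Fq a'_neq0) => //.
- by move=> l; apply: leq_ltn_trans (k_le l) lt_Kq.
- by move=> l; apply: leq_ltn_trans (k_le l) lt_KA.
Qed.

(** Three pairwise opposite elements would satisfy 2 a = 0, and the hypothesis on
    [q] excludes characteristic 2 when [n >= 3]. *)
Lemma nonopposite_pair (F : fieldType) n (a : n.-tuple F) q :
  natr_neq0_below F q -> (forall i, tnth a i != 0) -> (1 < n)%N ->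
  (n * (3 * n) <= 2 * q + 5 * n)%N -> delta a = 0%N ->
  exists i j : 'I_n, i != j /\ tnth a i + tnth a j != 0.
Proof.
move=> Fq a_neq0 n_gt1 le_nq.
case: n n_gt1 => [|[|[|m]]] // _ in a a_neq0 le_nq *.
  rewrite /delta /= => /eqP; rewrite eqb0 => a01.
  exists 0, 1; split=> //; apply: contraNneq a01 => sum0.
  by rewrite -addr_eq0 -(tnth_nth 0 a 0) -(tnth_nth 0 a 1) sum0.
move=> _.
pose i0 : 'I_m.+3 := 0; pose i1 : 'I_m.+3 := inord 1; pose i2 : 'I_m.+3 := inord 2.
have ne01 : i0 != i1 by rewrite -val_eqE /= inordK.
have ne02 : i0 != i2 by rewrite -val_eqE /= inordK.
have ne12 : i1 != i2 by rewrite -val_eqE /= !inordK.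
have [s01|] := eqVneq (tnth a i0 + tnth a i1) 0; last by exists i0, i1.
have [s02|] := eqVneq (tnth a i0 + tnth a i2) 0; last by exists i0, i2.
exists i1, i2; split=> //.
have -> : tnth a i1 + tnth a i2 = - (2%:R * tnth a i0).
  transitivity ((tnth a i0 + tnth a i1) + (tnth a i0 + tnth a i2) - 2%:R * tnth a i0).
    by ring.
  by rewrite s01 s02 addr0 add0r.
by rewrite oppr_eq0 mulf_neq0 //; apply: Fq; nia.
Qed.

(** Fixing the first variable and moving the second. This is what is left to use in
    characteristic 2, where the exponents are confined to {0, 1} and the polynomial
    method only sees two elements of [A]. *)
Lemma leq_pred_card_distinct_sums2 (F : fieldType) (a : 2.-tuple F) (A : {fset F}) :
  (forall i, tnth a i != 0) -> (#|` A|.-1 <= #|` distinct_sums a A|)%N.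
Proof.
move=> a_neq0; have [->|[x xA]] := fset_0Vmem A; first by rewrite cardfs0.
rewrite (cardfsD1 x A) xA /=.
pose f y := tnth a 0 * x + tnth a 1 * y.
have f_inj : injective f by move=> y z /addrI/(mulfI (a_neq0 1)).
have <- : #|` [fset f y | y in (A `\ x)%fset]%fset| = #|` (A `\ x)%fset|.
  by rewrite card_imfset.
apply: fsubset_leq_card.
apply/fsubsetP => c /imfsetP[y y_in ->].
move: y_in; rewrite /= in_fsetD1 => /andP[ne_yx yA].
apply/distinct_sumsP; exists (fun i => if i == 0 then x else y); split.
- by move=> i; case: ifP.
- by move=> [[|[|i]] lt_i] [[|[|j]] lt_j] //= _; rewrite eq_sym.
- rewrite !big_ord_recl big_ord0 addr0 /f /=.
  by congr (_ + tnth _ _ * _); apply: val_inj.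
Qed.

(** The level to reach is [min(N, q - 1 - delta)]. When it is at most [q - n], and
    in particular when [n = 1] or [delta a = 1], the windows have the slack they
    need; otherwise [5 n <= 2 K + 9] follows from the hypothesis on [q], and the
    level is reached exactly. *)
Lemma card_distinct_sums_ge (F : fieldType) n (a : n.-tuple F) (A : {fset F}) q :
  natr_neq0_below F q -> (forall i, tnth a i != 0) -> (0 < n)%N -> (1 < q)%N ->
  (n * (3 * n) <= 2 * q + 5 * n)%N -> (n <= #|` A|)%N ->
  (minn (q - delta a) (n * (#|` A| - n)).+1 <= #|` distinct_sums a A|)%N.
Proof.
move=> Fq a_neq0 n_gt0 q_gt1 le_nq le_nA.
set N := (n * (#|` A| - n))%N.
(* Exponents must stay below both [#|A|] and the bound [q]. *)
pose K := (minn #|` A| q).-1.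
have lt_Kq : (K < q)%N by rewrite /K; lia.
have lt_KA : (K < #|` A|)%N by rewrite /K; lia.
have slack := @ltn_card_distinct_sums_slack F n a A q K _ Fq a_neq0 lt_Kq lt_KA.
have exact_level s i j := @ltn_card_distinct_sums_exact F n a A q K s i j Fq a_neq0.
have [n1|n_neq1] := eqVneq n 1%N.
  have -> : delta a = 0%N by rewrite /delta (_ : (n == 2) = false) // n1.
  suff : (minn N q.-1 < #|` distinct_sums a A|)%N by lia.
  by apply: slack; rewrite /K /N n1 in le_nA *; lia.
have [d0|d_neq0] := eqVneq (delta a) 0%N; last first.
  have [n2 ->] : n = 2%N /\ delta a = 1%N.
    move: d_neq0; rewrite /delta; case: (n =P 2%N) => //= n2.
    by case: (_ == - _).
  suff : (minn N (q - 2) < #|` distinct_sums a A|)%N by lia.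
  by apply: slack; rewrite /K /N n2 in le_nA *; lia.
have n_gt1 : (1 < n)%N by lia.
have [i [j [ne_ij aij]]] := nonopposite_pair Fq a_neq0 n_gt1 le_nq d0.
rewrite d0 subn0.
suff : (minn N q.-1 < #|` distinct_sums a A|)%N by lia.
have [q2|q_neq2] := eqVneq q 2%N.
  have n2 : n = 2%N by nia.
  have [A2|A_neq2] := eqVneq #|` A| 2%N.
    by apply: (exact_level _ i j); rewrite // /K /N A2 n2; lia.
  apply: leq_trans (_ : 1 < _)%N; first by lia.
  move: (a) a_neq0; rewrite n2 => a' a'_neq0.
  by have := leq_pred_card_distinct_sums2 A a'_neq0; lia.
have le_nK : (n <= K.+1)%N by rewrite /K; nia.
have le_sK : (minn N q.-1 + n * n <= n * K + n)%N by rewrite /K /N; nia.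
have [le_sq|lt_qs] := leqP (minn N q.-1 + n) q.
  apply: slack => //; have := double_bin2 n.
  rewrite /N /K in le_sq *; nia.
apply: (exact_level _ i j) => //; last by lia.
rewrite /N /K in lt_qs *; nia.
Qed.

Theorem theorem1p1 (n : nat) (F : fieldType) (A : {fset F}) (a : n.-tuple F) :
  (0 < n)%N ->
  (forall i : 'I_n, tnth a i != 0) ->
  ((n%:R * (3 * n%:R - 5) / 2 : rat)%:E <= order_one F)%E ->
  (Order.min (order_one F - (delta a)%:R%:E)
             (n%:R * (#|` A|%:R - n%:R) + 1 : rat)%:E
     <= (#|` distinct_sums a A|%:R : rat)%:E)%E.
Proof.
move=> n_gt0 a_neq0.
(* With fewer than [n] elements the second argument of the minimum is at most 0. *)
have [lt_An _|le_nA] := ltnP #|` A| n.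
  rewrite ge_min; apply/orP; right; rewrite lee_fin.
  apply: le_trans (_ : 0 <= _); last exact: ler0n.
  have : #|` A|%:R + 1 <= n%:R :> rat by rewrite natr1 ler_nat.
  have : 1 <= n%:R :> rat by rewrite ler1n.
  by nra.
have -> : n%:R * (#|` A|%:R - n%:R) + 1 = (n * (#|` A| - n)).+1%:R :> rat.
  by rewrite -natrB // -natrM natr1.
have delta_le1 : (delta a <= 1)%N by apply: leq_b1.
rewrite /order_one; case: pselect => [exm|char0 _].
  case: ex_minnP => q /andP[q_gt0 q0] min_q; rewrite lee_fin => le_nq.
  have Fq : natr_neq0_below F q.
    move=> m /andP[m_gt0 lt_mq]; apply: contraL lt_mq => m0.
    by rewrite -leqNgt min_q ?m_gt0.
  have q_gt1 : (1 < q)%N.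
    by rewrite ltn_neqAle q_gt0 andbT; apply: contraTneq q0 => <-; apply: oner_neq0.
  have le_nq' : (n * (3 * n) <= 2 * q + 5 * n)%N.
    by rewrite -(ler_nat rat) !natrD !natrM; lra.
  have := card_distinct_sums_ge Fq a_neq0 n_gt0 q_gt1 le_nq' le_nA.
  rewrite geq_min ge_min -EFinB !lee_fin -natrB ?(leq_trans delta_le1) //.
  by rewrite !ler_nat.
(* In characteristic zero any large [q] does; this one makes the minimum of
   [card_distinct_sums_ge] equal to its second argument. *)
pose q := (n * (3 * n) + (n * (#|` A| - n)) + 3)%N.
have Fq : natr_neq0_below F q.
  by move=> m /andP[m_gt0 _]; apply: contra_notN char0 => m0; exists m; rewrite m_gt0.
have q_gt1 : (1 < q)%N by rewrite /q addn3.
have le_nq : (n * (3 * n) <= 2 * q + 5 * n)%N by rewrite /q; nia.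
have := card_distinct_sums_ge Fq a_neq0 n_gt0 q_gt1 le_nq le_nA.
rewrite (minn_idPr _) => [le_NC|]; last by rewrite /q; nia.
by rewrite ge_min !lee_fin ler_nat le_NC orbT.
Qed.
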